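(* Let $P_n$ denote the path on $n$ vertices. For integers $s,t\ge 2$, $$\mathrm{fix}(P_s*P_t)=\begin{cases}1 & \text{if } s,t\ge 4,\\ 2 & \text{if } s=2,\ t\ge 4,\\ 3 & \text{if } s=t=2 \text{ or } (s=2,\ t=3),\\ 5 & \text{if } s=t=3,\\ t+1 & \text{if } s=3,\ t\ge 4.\end{cases}$$
   Context: All graphs are finite and simple. For graphs $G_1,G_2$, the co-normal product $G_1*G_2$ is the graph with vertex set $V(G_1)\times V(G_2)$ in which $(a,b)$ and $(c,d)$ are adjacent if and only if $a$ is adjacent to $c$ in $G_1$ or $b$ is adjacent to $d$ in $G_2$. A set $F\subseteq V(G)$ is a fixing set of $G$ if the only automorphism of $G$ fixing every vertex of $F$ is the identity; $\mathrm{fix}(G)$ is the minimum cardinality of a fixing set. *)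

(* Defs.v *)
From mathcomp Require Import all_boot all_fingroup.

Set Implicit Arguments.
Unset Strict Implicit.
Unset Printing Implicit Defensive.

Record sgraph := SGraph {
  vertex :> finType;
  adj : rel vertex;
  adj_sym : symmetric adj;
  adj_irrefl : irreflexive adj }.

Section PathGraph.
Variable n : nat.

Definition path_adj : rel 'I_n :=
  [rel i j : 'I_n | (i.+1 == j) || (j.+1 == i)].

Lemma path_adj_sym : symmetric path_adj.
Proof. by move=> i j; rewrite /path_adj /= orbC. Qed.

Lemma path_adj_irrefl : irreflexive path_adj.
Proof. by move=> i; rewrite /path_adj /= orbb gtn_eqF. Qed.

Definition path_graph : sgraph := SGraph path_adj_sym path_adj_irrefl.
End PathGraph.

Section ConormalProduct.
Variables G1 G2 : sgraph.

Definition conormal_adj : rel (G1 * G2) :=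
  [rel u v : G1 * G2 | adj u.1 v.1 || adj u.2 v.2].

Lemma conormal_adj_sym : symmetric conormal_adj.
Proof. by move=> u v; rewrite /conormal_adj /= (adj_sym u.1) (adj_sym u.2). Qed.

Lemma conormal_adj_irrefl : irreflexive conormal_adj.
Proof. by move=> u; rewrite /conormal_adj /= !adj_irrefl. Qed.

Definition conormal : sgraph := SGraph conormal_adj_sym conormal_adj_irrefl.
End ConormalProduct.

Section FixingNumber.
Variable G : sgraph.

Definition automorphism (f : {perm G}) : bool :=
  [forall x : G, forall y : G, adj (f x) (f y) == adj x y].

Definition fixing_set (F : {set G}) : bool :=
  [forall f : {perm G},
    automorphism f ==> [forall x in F, f x == x] ==> (f == 1%g)].

Lemma fixing_setT : fixing_set [set: G].
Proof.
apply/forallP=> f; apply/implyP=> _; apply/implyP=> /forall_inP fT.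
by apply/eqP/permP=> x; rewrite perm1; apply/eqP/fT.
Qed.

(* The default value setT is a fixing set (fixing_setT), so the minimum
   ranges over a nonempty family. *)
Definition fixing_number : nat :=
  #|[arg min_(F < [set: G] | fixing_set F) #|F|]|.

Lemma fixing_number_exists :
  exists2 F : {set G}, fixing_set F & #|F| = fixing_number.
Proof.
rewrite /fixing_number; case: arg_minnP => [|F FF _]; first exact: fixing_setT.
by exists F.
Qed.

Lemma fixing_number_le (F : {set G}) : fixing_set F -> fixing_number <= #|F|.
Proof.
rewrite /fixing_number; case: arg_minnP => [|F0 _ min_F0].
  exact: fixing_setT.
exact: min_F0.
Qed.
End FixingNumber.

(* Main.v *)
(* The vertices not adjacent to (a,b) in P_s * P_t form the product ~N(a) x ~N(b), where ~ is
   complementation, so N(a,b) is contained in N(c,d) iff N(a) <= N(c) and N(b) <= N(d).  For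
   s, t >= 4 paths have no twins, hence a covering pair u < v of this order (which automorphisms
   preserve) differs in one coordinate only, and N(v) \ N(u) lies on a line.  The covers
   (0,b) < (2,b) thus force column 3 to be mapped into a line, and likewise row 3.  If the
   automorphism also fixes (0,1), it fixes column 3 and row 3 pointwise, hence column 0 and
   row 0, because N(0) = {1}, and finally everything.

   For s = 2, 3, the lower bounds come from twins and from reversing a single column whose
   vertices are adjacent to all the others. *)

Require Import Defs.
From mathcomp Require Import all_boot all_fingroup.
From mathcomp Require Import zify.

Set Implicit Arguments.
Unset Strict Implicit.
Unset Printing Implicit Defensive.

Local Arguments adj : simpl never.

(** * Automorphisms, twins and neighbourhood inclusion in a general graph *)

Section Automorphisms.
Variable G : sgraph.
Implicit Types (f : {perm G}) (F : {set G}).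

Lemma automorphismP f :
  reflect (forall x y, adj (f x) (f y) = adj x y) (automorphism f).
Proof.
apply: (iffP forallP) => [H x y | H x]; first by move/forallP: (H x) => /(_ y)/eqP.
by apply/forallP=> y; apply/eqP.
Qed.

Lemma fixing_setP F :
  reflect (forall f, automorphism f -> {in F, forall x, f x = x} -> f = 1%g)
          (fixing_set F).
Proof.
apply: (iffP forallP) => H f.
  move=> fA fF; move: (H f); rewrite fA /= => /implyP H'.
  by apply/eqP/H'/forall_inP=> x xF; rewrite fF.
by apply/implyP=> fA; apply/implyP=> /forall_inP fF; apply/eqP/H => // x /fF/eqP.
Qed.

(* The witnesses attached to distinct i have disjoint supports. *)
Lemma leq_card_fixing_number (T : finType) (p : G -> T) :
  (forall i, exists2 f, automorphism f & f != 1%g /\ forall x, f x != x -> p x = i) ->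
  #|T| <= fixing_number G.
Proof.
move=> H; have [F /fixing_setP FF <-] := fixing_number_exists G.
apply: leq_trans (leq_imset_card p F); rewrite -cardsT; apply/subset_leq_card.
apply/subsetP=> i _; have [f fA [/eqP f1 supp]] := H i.
apply: contra_notT f1 => iF; apply: FF => // x xF.
by apply: contraNeq iF => /supp <-; apply: imset_f.
Qed.

Lemma tperm_automorphism (x y : G) :
  (forall z, z != x -> z != y -> adj x z = adj y z) -> automorphism (tperm x y).
Proof.
move=> H; apply/automorphismP=> u v.
case: tpermP => [->|->|/eqP ux /eqP uy]; case: tpermP => [->|->|/eqP vx /eqP vy] //.
- by rewrite !adj_irrefl.
- by rewrite adj_sym.
- by rewrite H.
- by rewrite adj_sym.
- by rewrite !adj_irrefl.
- by rewrite H.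
- by rewrite !(adj_sym u) H.
- by rewrite !(adj_sym u) H.
Qed.

(* A fixing set omits at most one vertex of each class of twins. *)
Lemma leq_twin_fixing_number (T : finType) (p : G -> T) :
  (forall x y z, p x = p y -> z != x -> z != y -> adj x z = adj y z) ->
  #|G| - #|T| <= fixing_number G.
Proof.
move=> H; have [F /fixing_setP FF <-] := fixing_number_exists G.
rewrite leq_subLR -(cardsC F) addnC leq_add2r.
rewrite -(card_in_imset (f := p)) ?max_card // => x y.
rewrite !inE => xF yF pxy; apply/eqP; apply: contraTT isT => xy.
have /permP/(_ x) : tperm x y = 1%g.
  apply: FF => [|z zF]; first by apply: tperm_automorphism => z; apply: H.
  by rewrite tpermD //; [apply: contraNneq xF => -> | apply: contraNneq yF => ->].
by rewrite tpermL perm1 => yx; rewrite yx eqxx in xy.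
Qed.

(** An automorphism fixing [F] pointwise maps the complement of [F] to itself and preserves
    adjacency to each point of [F], so [F] cannot tell [f x] from [x]. *)
Lemma distinguishing_fixing_set F :
  (forall x y, x \notin F -> y \notin F ->
     {in F, forall z, adj x z = adj y z} -> x = y) -> fixing_set F.
Proof.
move=> H; apply/fixing_setP=> f /automorphismP fA fF; apply/permP=> x; rewrite perm1.
have [/fF // | xF] := boolP (x \in F); apply: H => // [|z zF].
  by apply: contra xF => fxF; rewrite -(perm_inj (fF _ fxF)).
by rewrite -{1}(fF z zF) fA.
Qed.

Definition nbr_sub (u v : G) := forall w, adj u w -> adj v w.

(** Covering in the preorder [nbr_sub]: coincidence with an endpoint is stated as a reverse
    inclusion, since distinct twins can have equal neighbourhoods. *)
Definition nbr_cover (u v : G) :=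
  nbr_sub u v /\ forall z, nbr_sub u z -> nbr_sub z v -> nbr_sub z u \/ nbr_sub v z.

Lemma nbr_sub_automorphism f u v :
  automorphism f -> nbr_sub (f u) (f v) <-> nbr_sub u v.
Proof.
move=> /automorphismP fA; split=> H w; first by move: (H (f w)); rewrite !fA.
by rewrite -(permKV f w) !fA; apply: H.
Qed.

Lemma nbr_cover_automorphism f u v :
  automorphism f -> nbr_cover u v -> nbr_cover (f u) (f v).
Proof.
move=> fA [uv H]; split=> [|z]; first exact/nbr_sub_automorphism.
by rewrite -(permKV f z) !nbr_sub_automorphism //; apply: H.
Qed.
End Automorphisms.

(** * Co-normal products: neighbourhoods and exchange of the factors *)

Lemma conormalE (G1 G2 : sgraph) (u v : conormal G1 G2) :
  adj u v = adj u.1 v.1 || adj u.2 v.2.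
Proof. by []. Qed.

Section Conormal.
Variables G1 G2 : sgraph.
Implicit Types (f : {perm conormal G1 G2}) (u v : conormal G1 G2).

Lemma nbr_sub_conormal u v : nbr_sub u v <-> nbr_sub u.1 v.1 /\ nbr_sub u.2 v.2.
Proof.
split=> [H|[H1 H2] w]; last first.
  by rewrite !conormalE => /orP[/H1|/H2] ->; rewrite ?orbT.
split=> w uw.
  (* As [v.2] is not adjacent to itself, only the first coordinate can make [v] adjacent to
     [(w, v.2)]. *)
  by move: (H (w, v.2)); rewrite !conormalE /= uw adj_irrefl orbF; apply.
by move: (H (v.1, w)); rewrite !conormalE /= uw orbT adj_irrefl; apply.
Qed.

(** Transfers statements about columns to rows. *)
Lemma automorphism_swap f : automorphism f ->
  exists2 f' : {perm conormal G2 G1}, automorphism f' &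
    forall a b, f' (b, a) = ((f (a, b)).2, (f (a, b)).1).
Proof.
move=> /automorphismP fA.
pose g (x : conormal G2 G1) : conormal G2 G1 :=
  let y := f (x.2, x.1) in (y.2, y.1).
have g_inj : injective g.
  move=> [b a] [d c] []; rewrite /= => E2 E1.
  suff /perm_inj[-> ->] : f (a, b) = f (c, d) by [].
  by apply/eqP; rewrite -pair_eqE /= E1 E2 !eqxx.
exists (perm g_inj) => [|a b]; last by rewrite permE.
apply/automorphismP=> x y; rewrite !permE.
have := fA (x.2, x.1) (y.2, y.1); rewrite !conormalE /= => E.
by rewrite /g /= orbC E orbC.
Qed.
End Conormal.


(** * Paths: absence of twins and rigidity *)

Lemma path_adjE n (i j : path_graph n) :
  adj i j = ((i : 'I_n).+1 == j :> nat) || ((j : 'I_n).+1 == i :> nat).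
Proof. by []. Qed.

Definition path_vtx n m (lt_m : m < n) : path_graph n := Ordinal lt_m.

Local Notation vtx k := (path_vtx (isT : k < _.+4)).

Section Path.
Variable n : nat.
Local Notation P := (path_graph n.+4).
Implicit Types i j k a b c x y : P.

Lemma path_thin i j : (forall k, adj i k = adj j k) -> i = j.
Proof.
suff H (x y : P) : (forall k, adj x k = adj y k) -> (x : 'I_n.+4) <= (y : 'I_n.+4).
  by move=> E; apply/val_inj/eqP; rewrite eqn_leq !H.
move=> E; case: leqP => // lt_yx; case: (posnP (y : 'I_n.+4)) => [y0 | y_gt0].
(* A larger twin of 0 would be adjacent to 1, hence equal to 2, but 3 separates 2 from 0. *)
- have := E (vtx 1); have := E (vtx 3).
  by rewrite !path_adjE /=; lia.
have lt_y : (y : 'I_n.+4).-1 < n.+4 by case: (y) => /= *; lia.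
by have := E (path_vtx lt_y); rewrite !path_adjE /=; lia.
Qed.

Lemma path_nbr_sub_anti i j : nbr_sub i j -> nbr_sub j i -> i = j.
Proof. by move=> ij ji; apply: path_thin => k; apply/idP/idP; [apply: ij | apply: ji]. Qed.

(** [N(c)] has at most two points and contains the nonempty set [N(a)]. *)
Lemma path_nbr_sub_diff a c x y : nbr_sub a c ->
  adj c x -> adj c y -> ~~ adj a x -> ~~ adj a y -> x = y.
Proof.
move=> ac cx cy ax ay; apply: val_inj => /=.
have [z az] : exists z, adj a z.
  case: (posnP (a : 'I_n.+4)) => [a0 | a_gt0].
    by exists (vtx 1); rewrite path_adjE /=; lia.
  have lt_a : (a : 'I_n.+4).-1 < n.+4 by case: (a) => /= *; lia.
  by exists (path_vtx lt_a); rewrite path_adjE /=; lia.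
have := ac z az; move: cx cy ax ay az; rewrite !path_adjE; lia.
Qed.

(** Induction along the path: [h (m+1)] is adjacent to [h m = m], and injectivity excludes
    [m-1 = h (m-1)]. *)
Lemma path_endo_id0 (h : P -> P) : injective h ->
  (forall i j, adj i j -> adj (h i) (h j)) ->
  h (vtx 0) = vtx 0 -> h =1 id.
Proof.
move=> h_inj h_adj h0 i; apply: val_inj => /=; move: i.
suff H m : forall i, (i : 'I_n.+4) <= m -> (h i : 'I_n.+4) = i :> nat.
  by move=> i; apply: (H i).
elim: m => [|m IH] i.
  by rewrite leqn0 => /eqP i0; rewrite (_ : i = vtx 0) ?h0 //; apply: val_inj.
rewrite leq_eqVlt => /orP[/eqP im|]; last by rewrite ltnS; apply: IH.
have lt_m : m < n.+4 by case: (i) im => /= *; lia.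
have /= hm := IH (path_vtx lt_m) (leqnn m); have := h_adj i (path_vtx lt_m).
rewrite !path_adjE /= hm im eqxx orbT => /(_ isT)/orP[/eqP hi|/eqP //].
have lt_m1 : m.-1 < n.+4 by lia.
have /= hm1 := IH (path_vtx lt_m1) (leq_pred m).
have /h_inj : h i = h (path_vtx lt_m1) by apply: val_inj => /=; rewrite hm1; lia.
by move/(congr1 (fun z : P => (z : 'I_n.+4) : nat)) => /=; lia.
Qed.

(** The vertices 0 and 2 stay or are exchanged; if exchanged, [h 3] is adjacent to 0, hence equals
    [1 = h 1]. *)
Lemma path_endo_id1 (h : P -> P) : injective h ->
  (forall i j, adj i j -> adj (h i) (h j)) ->
  h (vtx 1) = vtx 1 -> h =1 id.
Proof.
move=> h_inj h_adj h1; apply: path_endo_id0 => //; apply: val_inj => /=.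
set v0 : P := vtx 0; set v1 := path_vtx _ in h1.
pose v2 : P := vtx 2; pose v3 : P := vtx 3.
have h01 : adj (h v0) (h v1) by apply: h_adj.
have h12 : adj (h v1) (h v2) by apply: h_adj.
have h23 : adj (h v2) (h v3) by apply: h_adj.
have h02 : (h v0 : 'I_n.+4) <> (h v2 : 'I_n.+4) :> nat by move=> /val_inj/h_inj.
have h13 : (h v1 : 'I_n.+4) <> (h v3 : 'I_n.+4) :> nat by move=> /val_inj/h_inj.
by move: h01 h12 h23 h02 h13; rewrite h1 !path_adjE /=; lia.
Qed.
End Path.

(** * Reversal and rigidity of columns *)

Section FlipColumns.
Variables (G1 : sgraph) (n : nat) (C : pred G1).
Local Notation G := (conormal G1 (path_graph n.+2)).

(** The columns in [C] are all reversed at once: this preserves adjacency among them, and every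
    vertex in them is adjacent to every vertex outside. *)
Lemma exists_column_flip : (forall a c, C a -> ~~ C c -> adj a c) -> (exists c, C c) ->
  exists2 f : {perm G}, automorphism f & f != 1%g /\ forall x, f x != x -> C x.1.
Proof.
move=> domC [c Cc].
pose g (x : G) : G := (x.1, if C x.1 then rev_ord (x.2 : 'I_n.+2) else x.2).
have gK : involutive g by case=> a b; rewrite /g /=; case: (C a) => //; rewrite rev_ordK.
exists (perm (can_inj gK)); last split.
- apply/automorphismP=> x y; rewrite !permE !conormalE /=.
  case: ifP => Cx; case: ifP => Cy //.
  + congr orb; case: (x.2) (y.2) => [i i_lt] [j j_lt] /=; rewrite !path_adjE /=; lia.
  + by rewrite domC ?Cy.
  + by rewrite adj_sym domC ?Cx.
- apply/eqP=> /permP/(_ (c, ord0)); rewrite permE perm1 /g /= Cc => -[].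
  by lia.
- by move=> x; rewrite permE /g; case: ifP => // _; rewrite -surjective_pairing eqxx.
Qed.
End FlipColumns.

Section LongPathFactor.
Variables (G1 : sgraph) (n : nat).
Local Notation P := (path_graph n.+4).
Local Notation G := (conormal G1 P).
Implicit Types (f : {perm G}) (c : G1) (b : P).

Lemma column_id f c : automorphism f ->
  (forall b, (f (c, b)).1 = c) -> f (c, vtx 0) = (c, vtx 0) -> forall b, f (c, b) = (c, b).
Proof.
move=> /automorphismP fA fc f0 b.
have fE d : f (c, d) = (c, (f (c, d)).2) by rewrite -{2}(fc d) -surjective_pairing.
rewrite fE (@path_endo_id0 _ (fun d => (f (c, d)).2)) //=.
- move=> d e E; have : f (c, d) = f (c, e) by rewrite fE E -fE.
  by move/perm_inj => [].
- by move=> d e de; move: (fA (c, d) (c, e)); rewrite !conormalE !fc /= adj_irrefl de.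
- by rewrite f0.
Qed.
End LongPathFactor.

(** * Both paths with at least four vertices *)

Section LongPaths.
Variables m n : nat.
Local Notation P := (path_graph m.+4).
Local Notation Q := (path_graph n.+4).
Local Notation G := (conormal P Q).
Implicit Types (u v w x y : G) (f : {perm G}).

Lemma nbr_cover_diff_line u v : nbr_cover u v ->
  (forall x y, adj v x -> ~~ adj u x -> adj v y -> ~~ adj u y -> x.1 = y.1) \/
  (forall x y, adj v x -> ~~ adj u x -> adj v y -> ~~ adj u y -> x.2 = y.2).
Proof.
case: u v => [a b] [c d] [/nbr_sub_conormal[/= ac bd] cov].
(* The vertex [(a, d)] lies between [(a, b)] and [(c, d)], so the cover forces [b = d] or
   [a = c]. *)
case: (cov (a, d)); try by apply/nbr_sub_conormal; split => /=.
- move/nbr_sub_conormal => [/= _ /(path_nbr_sub_anti bd) bd']; left; subst d => x y.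
  rewrite !conormalE /= => /orP[cx|xb] /norP[ax xb']; last by case/negP: xb'.
  move=> /orP[cy|yb] /norP[ay yb']; last by case/negP: yb'.
  exact: (path_nbr_sub_diff ac).
- move/nbr_sub_conormal => [/= /(path_nbr_sub_anti ac) ac' _]; right; subst c => x y.
  rewrite !conormalE /= => /orP[xa|dx] /norP[xa' bx]; first by case/negP: xa'.
  move=> /orP[ya|dy] /norP[ya' yb]; first by case/negP: ya'.
  exact: (path_nbr_sub_diff bd).
Qed.


(** Since 0 is adjacent to 1, any [c] with [N(0)] inside [N(c)] is a neighbour of 1, that is 0 or
    2. *)
Lemma nbr_cover_02 (b : Q) : nbr_cover ((vtx 0, b) : G) (vtx 2, b).
Proof.
split=> [|[c d]].
  by apply/nbr_sub_conormal; split=> //= w; rewrite !path_adjE /=; lia.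
move=> /nbr_sub_conormal[/= c0 bd] /nbr_sub_conormal[/= c2 db].
have <- : b = d by apply: path_nbr_sub_anti.
have [-> | ->] : c = vtx 0 \/ c = vtx 2; [|by left|by right].
have := c0 (vtx 1); rewrite !path_adjE /= => /(_ isT) H.
case/orP: H => H; [left|right]; apply: val_inj => /=; lia.
Qed.

(* The differences of the covers (0,b) < (2,b) are the sets {3} x ~N(b); those for
   b = 0 and b = 3 cover the column 3 and share its points 0 and 3. *)
Lemma column3_line f : automorphism f ->
  (forall b d, (f (vtx 3, b)).1 = (f (vtx 3, d)).1) \/
  (forall b d, (f (vtx 3, b)).2 = (f (vtx 3, d)).2).
Proof.
move=> fA; have H (e : Q) :
    (forall b d, ~~ adj e b -> ~~ adj e d -> (f (vtx 3, b)).1 = (f (vtx 3, d)).1) \/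
    (forall b d, ~~ adj e b -> ~~ adj e d -> (f (vtx 3, b)).2 = (f (vtx 3, d)).2).
  have /automorphismP fE := fA.
  case: (nbr_cover_diff_line (nbr_cover_automorphism fA (nbr_cover_02 e))) => K;
    [left|right] => b d eb ed; apply: K; by rewrite fE conormalE //= negb_or.
have out (b : Q) : ~~ adj (vtx 0) b \/ ~~ adj (vtx 3) b by rewrite !path_adjE /=; lia.
have neq : (f (vtx 3, vtx 0)).1 = (f (vtx 3, vtx 3)).1 ->
    (f (vtx 3, vtx 0)).2 <> (f (vtx 3, vtx 3)).2.
  move=> E1 E2; have : f (vtx 3, vtx 0) = f (vtx 3, vtx 3).
    by apply/eqP; rewrite -pair_eqE /pair_eq E1 E2 !eqxx.
  by move/perm_inj.
case: (H (vtx 0)) (H (vtx 3)) => K0 [K3|K3].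
- left=> b d; transitivity (f (vtx 3, vtx 0)).1; last symmetry.
    by case: (out b) => ?; [apply: K0 | apply: K3].
  by case: (out d) => ?; [apply: K0 | apply: K3].
(* In the mixed cases the images of (3,0) and (3,3) would agree in both coordinates. *)
- by case: (neq _ _); [apply: K0 | apply: K3].
- by case: (neq _ _); [apply: K3 | apply: K0].
- right=> b d; transitivity (f (vtx 3, vtx 0)).2; last symmetry.
    by case: (out b) => ?; [apply: K0 | apply: K3].
  by case: (out d) => ?; [apply: K0 | apply: K3].
Qed.

(** Stated for general [(p, q)] because it serves both [f], fixing (0,1), and its swap, fixing
    (1,0). *)
Lemma column3_fixed f p (q : Q) : automorphism f -> f (p, q) = (p, q) ->
  ~~ adj p (vtx 3) -> (q : 'I_n.+4) <= 1 ->
  (forall b d, (f (vtx 3, b)).1 = (f (vtx 3, d)).1) ->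
  forall b, f (vtx 3, b) = ((f (vtx 3, vtx 0)).1, b).
Proof.
move=> /automorphismP fA fpq pp3 q_le1 f1 b.
have fE d : f (vtx 3, d) = ((f (vtx 3, vtx 0)).1, (f (vtx 3, d)).2).
  by rewrite -(f1 d) -surjective_pairing.
pose h d := (f (vtx 3, d)).2.
have h_inj : injective h.
  by move=> d e E; have : f (vtx 3, d) = f (vtx 3, e);
    [rewrite fE [RHS]fE -/(h d) E | case/perm_inj].
have h_adj d e : adj d e -> adj (h d) (h e).
  by move=> de; move: (fA (vtx 3, d) (vtx 3, e)); rewrite fE [f (vtx 3, e)]fE !conormalE /= adj_irrefl de.
(* Testing at [e = q] shows that [p] is not adjacent to the image column, so only the second
   coordinate counts. *)
have qh d : adj q (h d) = adj q d.
  have E e : adj p (f (vtx 3, vtx 0)).1 || adj q (h e) = adj q e.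
    by move: (fA (p, q) (vtx 3, e)); rewrite fpq [f (vtx 3, e)]fE !conormalE /= (negbTE pp3).
  by move: (E d) (E q); rewrite adj_irrefl => <- /norP[/negbTE -> _].
(* [h 1 = 1]: for [q = 0] it is the only neighbour of [q]; for [q = 1] the set {0,2} is preserved
   and 1 is its common neighbour. *)
rewrite fE -/(h b) (path_endo_id1 h_inj h_adj) //; apply: val_inj => /=.
have := qh (vtx 1); have := qh (vtx 0); have := qh (vtx 2).
have := h_adj (vtx 0) (vtx 1) isT; have := h_adj (vtx 1) (vtx 2) isT.
have : (h (vtx 0) : 'I_n.+4) <> (h (vtx 2) : 'I_n.+4) :> nat by move/val_inj/h_inj.
by rewrite !path_adjE /=; lia.
Qed.

(** If column 3 went into a row, (3,0) and (3,2), adjacent to (0,1), would have images whose first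
    coordinates are both adjacent to 0, hence both equal to 1. *)
Lemma column3_not_row f (p : P) (q : Q) : automorphism f -> f (p, q) = (p, q) ->
  ~~ adj p (vtx 3) -> (p : 'I_m.+4) = 0 :> nat -> (q : 'I_n.+4) = 1 :> nat ->
  forall b d, (f (vtx 3, b)).1 = (f (vtx 3, d)).1.
Proof.
move=> fA fpq pp3 p_0 q_1; case: (column3_line fA) => // f2.
move/automorphismP: (fA) => fE.
have fE' d : f (vtx 3, d) = ((f (vtx 3, d)).1, (f (vtx 3, vtx 0)).2).
  by rewrite -(f2 d) -surjective_pairing.
pose h d := (f (vtx 3, d)).1.
have h_inj : injective h.
  by move=> d e E; have : f (vtx 3, d) = f (vtx 3, e);
    [rewrite fE' [RHS]fE' -/(h d) E | case/perm_inj].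
have ph d : adj p (h d) || adj q (f (vtx 3, vtx 0)).2 = adj q d.
  by move: (fE (p, q) (vtx 3, d)); rewrite fpq [f (vtx 3, d)]fE' !conormalE /= (negbTE pp3).
have : (h (vtx 0) : 'I_m.+4) <> (h (vtx 2) : 'I_m.+4) :> nat by move/val_inj/h_inj.
move: (ph (vtx 0)) (ph (vtx 2)) (ph (vtx 1)); rewrite !path_adjE /=; lia.
Qed.

(** A vertex is adjacent to all of column 3 exactly when its first coordinate is adjacent to 3;
    otherwise its neighbours in that column determine its second coordinate. *)
Lemma column3_fixed_snd f : automorphism f -> (forall b, f (vtx 3, b) = (vtx 3, b)) ->
  forall x, adj (f x).1 (vtx 3) = adj x.1 (vtx 3) /\ (~~ adj x.1 (vtx 3) -> (f x).2 = x.2).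
Proof.
move=> /automorphismP fA f3 x.
have E d : adj (f x).1 (vtx 3) || adj (f x).2 d = adj x.1 (vtx 3) || adj x.2 d.
  by have := fA x (vtx 3, d); rewrite f3 !conormalE.
have E1 : adj (f x).1 (vtx 3) = adj x.1 (vtx 3).
  move: (E (f x).2) (E x.2); rewrite !adj_irrefl !orbF.
  by case: (adj (f x).1 (vtx 3)); case: (adj x.1 (vtx 3)).
split=> // x3; apply: path_thin => d; move: (E d).
by rewrite E1 (negbTE x3).
Qed.
End LongPaths.

Lemma cross_fixed_snd m n (f : {perm conormal (path_graph m.+4) (path_graph n.+4)}) :
  automorphism f -> (forall b, f (vtx 3, b) = (vtx 3, b)) ->
  (forall a, f (a, vtx 3) = (a, vtx 3)) -> forall x, (f x).2 = x.2.
Proof.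
move=> fA fcol frow x; have S2 := column3_fixed_snd fA fcol.
have S1 y : ~~ adj y.2 (vtx 3) -> (f y).1 = y.1.
  have [f' f'A f'E] := automorphism_swap fA; case: y => a b y3.
  have f'3 d : f' (vtx 3, d) = (vtx 3, d) by rewrite f'E frow.
  by have [_ /(_ y3)] := column3_fixed_snd f'A f'3 (b, a); rewrite f'E.
have /automorphismP fE := fA.
have f10 : f (vtx 1, vtx 0) = (vtx 1, vtx 0).
  by rewrite [LHS]surjective_pairing S1 // (proj2 (S2 _)).
have f0 d : f (vtx 0, d) = (vtx 0, d).
  rewrite [LHS]surjective_pairing (proj2 (S2 _)) //=; congr pair.
  have [d3|d3] := boolP (adj d (vtx 3)); last exact: (S1 (vtx 0, d)).
  (* For [d] adjacent to 3, the image has first coordinate adjacent to 1, as [d] is not adjacent to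
     0, but not adjacent to 3; this leaves 0. *)
  have := fE (vtx 0, d) (vtx 1, vtx 0); have := proj1 (S2 (vtx 0, d)).
  rewrite f10 !conormalE /= (proj2 (S2 _)) //=.
  move: d3 (f _).1 => d3 a; rewrite !path_adjE in d3 *; move: d3 => /= d3 a3 a1.
  by apply: val_inj => /=; lia.
have [x3|/(proj2 (S2 x)) //] := boolP (adj x.1 (vtx 3)).
have fx3 : adj (f x).1 (vtx 3) by rewrite (proj1 (S2 x)).
apply: path_thin => d; have := fE x (vtx 0, d); rewrite f0 !conormalE /=.
(* Column 0 reads off second coordinates where column 3 cannot: no vertex is adjacent to both 0 and
   3. *)
have out (a : path_graph m.+4) : adj a (vtx 3) -> adj a (vtx 0) = false.
  by rewrite !path_adjE /=; lia.
by rewrite !out.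
Qed.

Lemma long_paths_fixing_set m n :
  fixing_set [set ((vtx 0, vtx 1) : conormal (path_graph m.+4) (path_graph n.+4))].
Proof.
apply/fixing_setP=> f fA fF.
have {fF}f01 : f (vtx 0, vtx 1) = (vtx 0, vtx 1) by apply: fF; rewrite inE.
have [f' f'A f'E] := automorphism_swap fA.
have f'10 : f' (vtx 1, vtx 0) = (vtx 1, vtx 0) by rewrite f'E f01.
have fcol := column3_fixed fA f01 isT isT (column3_not_row fA f01 isT erefl erefl).
have frow : forall b d, (f' (vtx 3, b)).1 = (f' (vtx 3, d)).1.
  case: (column3_line f'A) => // H.
  (* Otherwise (0,3) would be sent into the column that column 3 already fills. *)
  have E : (f (vtx 0, vtx 3)).1 = (f (vtx 3, vtx 3)).1.
    by have := H (vtx 0) (vtx 3); rewrite !f'E.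
  have : f (vtx 0, vtx 3) = f (vtx 3, (f (vtx 0, vtx 3)).2).
    by rewrite fcol [LHS]surjective_pairing E fcol.
  by move/perm_inj => [].
have f'col := column3_fixed f'A f'10 isT isT frow.
have E a : f (a, vtx 3) = (a, (f (vtx 0, vtx 3)).2).
  by have := f'col a; rewrite !f'E => -[E2 E1]; rewrite [LHS]surjective_pairing E1 E2.
(* The common point (3,3) of the two lines identifies both images. *)
have [E1 E2] : (f (vtx 3, vtx 0)).1 = vtx 3 /\ vtx 3 = (f (vtx 0, vtx 3)).2.
  by have H := fcol (vtx 3); rewrite E in H; split; [have := congr1 fst H | have := congr1 snd H].
have fcol' b : f (vtx 3, b) = (vtx 3, b) by rewrite fcol E1.
have frow' a : f (a, vtx 3) = (a, vtx 3) by rewrite E -E2.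
apply/permP=> -[a b]; rewrite perm1 [LHS]surjective_pairing.
rewrite (cross_fixed_snd fA) //=.
have := @cross_fixed_snd _ _ f' f'A _ _ (b, a); rewrite f'E /= => -> // d.
  by rewrite f'E frow'.
by rewrite f'E fcol'.
Qed.

Lemma fixing_number_long_paths m n :
  fixing_number (conormal (path_graph m.+4) (path_graph n.+4)) = 1.
Proof.
apply/eqP; rewrite eqn_leq; apply/andP; split.
  by apply: leq_trans (fixing_number_le (long_paths_fixing_set m n)) _; rewrite cards1.
rewrite -card_unit; apply: (leq_card_fixing_number (p := fun=> tt)) => -[].
have [] := @exists_column_flip (path_graph m.+4) n.+2 predT; [by []|by exists ord0|].
by move=> f fA [f1 _]; exists f.
Qed.

(** * First factor with two or three vertices *)

Local Notation o2 k := (Ordinal (isT : k < 2)).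
Local Notation o3 k := (Ordinal (isT : k < 3)).

Lemma path2_adjE (i j : path_graph 2) : adj i j = (i != j).
Proof. by case: i j => [[|[|i]] ?] [[|[|j]] ?]. Qed.

Lemma path3_cases (i : path_graph 3) : [\/ i = o3 0, i = o3 1 | i = o3 2].
Proof.
by case: i => [[|[|[|i]]] Hi] //;
  [apply: Or31|apply: Or32|apply: Or33]; apply: val_inj.
Qed.

Lemma fixing_number_path2_long n :
  fixing_number (conormal (path_graph 2) (path_graph n.+4)) = 2.
Proof.
apply/eqP; rewrite eqn_leq; apply/andP; split; last first.
  rewrite -[X in X <= _](card_ord 2).
  apply: (@leq_card_fixing_number (conormal (path_graph 2) (path_graph n.+4)) 'I_2 fst) => c.
  have [||f fA [f1 fc]] := @exists_column_flip (path_graph 2) n.+2 (pred1 c).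
  - by move=> a b /eqP ->; rewrite path2_adjE eq_sym.
  - by exists c; rewrite /= eqxx.
  - by exists f => //; split=> // x /fc/eqP.
pose F : {set conormal (path_graph 2) (path_graph n.+4)} :=
  [set (o2 0, vtx 0); (o2 1, vtx 0)].
suff FF : fixing_set F by apply: leq_trans (fixing_number_le FF) _; rewrite cards2.
apply/fixing_setP=> f fA fF; apply/permP=> -[c b]; rewrite perm1.
have fc0 (d : path_graph 2) : f (d, vtx 0) = (d, vtx 0).
  apply: fF; rewrite !inE !xpair_eqE eqxx !andbT.
  by case: d => [[|[|]] ?].
have /automorphismP fE := fA.
have near d : ~~ adj d (vtx 0) -> (f (c, d)).1 = c.
  move=> d0; have := fE (c, d) (c, vtx 0); rewrite fc0 !conormalE /= adj_irrefl (negbTE d0).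
  by rewrite path2_adjE => /norP[/negPn/eqP].
apply: column_id => // d.
have [d0|/near //] := boolP (adj d (vtx 0)).
(* Row 1, the only row adjacent to row 0, is compared with row 3, already known to keep its
   columns. *)
have d3 : ~~ adj d (vtx 3) by move: d0; rewrite !path_adjE /=; lia.
have := fE (c, d) (c, vtx 3); rewrite !conormalE /= adj_irrefl (negbTE d3) (near (vtx 3)) //.
by rewrite path2_adjE => /norP[/negPn/eqP].
Qed.

(** The [t + 1] disjoint supports are the twin pairs [{(0,b), (2,b)}], indexed by [Some b], and the
    central column, indexed by [None]. *)
Lemma fixing_number_path3_long n :
  fixing_number (conormal (path_graph 3) (path_graph n.+4)) = n.+4.+1.
Proof.
pose G := conormal (path_graph 3) (path_graph n.+4).
apply/eqP; rewrite eqn_leq; apply/andP; split; last first.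
  rewrite -[X in X <= _](congr1 S (card_ord n.+4)) -card_option.
  apply: (@leq_card_fixing_number G _ (fun x => if x.1 == o3 1 then None else Some x.2)).
  case=> [b|].
    exists (tperm ((o3 0, b) : G) (o3 2, b)).
      apply: tperm_automorphism => -[a d] _ _; rewrite !conormalE /=; congr orb.
      by case: (path3_cases a) => ->.
    split; first by apply/eqP=> /permP/(_ (o3 0, b)); rewrite tpermL perm1.
    by move=> x; case: tpermP => [->|->|] //; rewrite eqxx.
  have [||f fA [f1 fc]] := @exists_column_flip (path_graph 3) n.+2 (pred1 (o3 1)).
  - by move=> a c /eqP ->; case: (path3_cases c) => ->.
  - by exists (o3 1).
  - by exists f => //; split=> // x /fc /= ->.
pose F : {set G} := (o3 1, vtx 0) |: [set (o3 2, b) | b : path_graph n.+4].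
suff FF : fixing_set F.
  apply: leq_trans (fixing_number_le FF) _; rewrite cardsU1 -[X in _ <= X]add1n.
  apply: leq_add; first by case: (_ \notin _).
  by apply: leq_trans (leq_imset_card _ _) _; rewrite card_ord.
apply/fixing_setP=> f fA fF.
have f2 b : f (o3 2, b) = (o3 2, b) by apply: fF; rewrite !inE imset_f ?orbT.
have f10 : f (o3 1, vtx 0) = (o3 1, vtx 0) by apply: fF; rewrite !inE eqxx.
have /automorphismP fE := fA.
have E x d : adj (f x).1 (o3 2) || adj (f x).2 d = adj x.1 (o3 2) || adj x.2 d.
  by have := fE x (o3 2, d); rewrite f2 !conormalE.
apply/permP=> -[a b]; rewrite perm1; case: (path3_cases a) => -> //.
- have E2 : (f (o3 0, b)).1 != o3 1.
    apply/eqP=> E1; move: (E (o3 0, b) b); rewrite E1 /= adj_irrefl; done.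
  have /path_thin E3 : forall d, adj (f (o3 0, b)).2 d = adj b d.
    by move=> d; move: (E (o3 0, b) d); case: (path3_cases (f (o3 0, b)).1) E2 => ->.
  rewrite [LHS]surjective_pairing E3.
  case: (path3_cases (f (o3 0, b)).1) E2 => E1 E2; rewrite ?E1 //; first by rewrite E1 in E2.
  have : f (o3 0, b) = f (o3 2, b) by rewrite f2 [LHS]surjective_pairing E3 E1.
  by move/perm_inj.
(* A central vertex is adjacent to all of the fixed column 2; a vertex of column 0 or 2 misses the
   point in its own row. *)
- apply: column_id => // d; move: (E (o3 1, d) (f (o3 1, d)).2); rewrite adj_irrefl orbF.
  by case: (path3_cases (f (o3 1, d)).1) => ->.
Qed.

Lemma fixing_number_path22 : fixing_number (conormal (path_graph 2) (path_graph 2)) = 3.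
Proof.
pose G := conormal (path_graph 2) (path_graph 2).
have cardG : #|G| = 4 by rewrite card_prod !card_ord.
apply/eqP; rewrite eqn_leq; apply/andP; split.
  rewrite (_ : 3 = #|[set~ ((o2 0, o2 0) : G)]|); last by rewrite cardsC1 cardG.
  apply/fixing_number_le/distinguishing_fixing_set => x y.
  (* The graph is complete on four vertices; a single vertex is omitted. *)
  by rewrite !inE !negbK => /eqP -> /eqP ->.
apply: leq_trans (_ : #|G| - #|{: unit}| <= _); first by rewrite cardG card_unit.
apply: (@leq_twin_fixing_number G unit (fun=> tt)) => x y z _ zx zy.
have adjG (u v : G) : v != u -> adj u v.
  case: u v => [a b] [c d]; rewrite xpair_eqE conormalE !path2_adjE /=.
  by rewrite negb_and !(eq_sym a) !(eq_sym b).
by rewrite !adjG.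
Qed.

Lemma fixing_number_path23 : fixing_number (conormal (path_graph 2) (path_graph 3)) = 3.
Proof.
pose G := conormal (path_graph 2) (path_graph 3).
have cardG : #|G| = 6 by rewrite card_prod !card_ord.
apply/eqP; rewrite eqn_leq; apply/andP; split.
  pose F : {set G} := [set x in [:: (o2 0, o3 2); (o2 1, o3 2); (o2 1, o3 1)]].
  suff FF : fixing_set F.
    by apply: leq_trans (fixing_number_le FF) _; rewrite cardsE; apply: card_size.
  apply: distinguishing_fixing_set => x y xF yF H.
  have := H (o2 0, o3 2); have := H (o2 1, o3 2); move: xF yF {H}.
  rewrite !inE !eqxx !orbT !conormalE /=.
  case: x y => [[[|[|a]] ha] b] [[[|[|c]] hc] d] //;
    case: (path3_cases b) => ->; case: (path3_cases d) => -> //= _ _ H1 H2;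
    try by [move: (H1 isT) | move: (H2 isT)];
    by congr pair; apply: val_inj.
apply: leq_trans (_ : #|G| - #|'I_3| <= _); first by rewrite cardG card_ord.
(* Three twin pairs: the middle row, and the two ends of each column; [F] takes one vertex of
   each. *)
pose p (x : G) : 'I_3 := if x.2 == o3 1 then o3 2 else if x.1 == o2 0 then o3 0 else o3 1.
apply: (@leq_twin_fixing_number G 'I_3 p) => x y z; rewrite /p !conormalE.
case: x y z => [[[|[|a]] ha] b] [[[|[|c]] hc] d] [[[|[|e]] he] g] //;
    case: (path3_cases b) => ->; case: (path3_cases d) => ->;
    case: (path3_cases g) => -> //.
Qed.

Lemma fixing_number_path33 : fixing_number (conormal (path_graph 3) (path_graph 3)) = 5.
Proof.
pose G := conormal (path_graph 3) (path_graph 3).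
have cardG : #|G| = 9 by rewrite card_prod !card_ord.
apply/eqP; rewrite eqn_leq; apply/andP; split.
  pose F : {set G} :=
    [set x in [:: (o3 0, o3 2); (o3 2, o3 0); (o3 2, o3 2); (o3 1, o3 2); (o3 2, o3 1)]].
  suff FF : fixing_set F.
    by apply: leq_trans (fixing_number_le FF) _; rewrite cardsE; apply: card_size.
  apply: distinguishing_fixing_set => x y xF yF H.
  have := H (o3 2, o3 2); have := H (o3 1, o3 2); have := H (o3 2, o3 1); move: xF yF {H}.
  rewrite !inE !eqxx !orbT !conormalE /=.
  case: x y => [a b] [c d].
  case: (path3_cases a) => ->; case: (path3_cases b) => ->;
    case: (path3_cases c) => ->; case: (path3_cases d) => -> //= _ _ H1 H2 H3;
    by [move: (H1 isT) | move: (H2 isT) | move: (H3 isT)].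
apply: leq_trans (_ : #|G| - #|{: bool * bool}| <= _).
  by rewrite cardG card_prod card_bool.
(* Four twin classes, of sizes 4, 2, 2 and 1; [F] omits one vertex of each. *)
pose p (x : G) := (x.1 == o3 1, x.2 == o3 1).
apply: (@leq_twin_fixing_number G _ p) => x y z; rewrite /p !conormalE.
case: x y z => [a b] [c d] [e g].
case: (path3_cases a) => ->; case: (path3_cases b) => ->;
  case: (path3_cases c) => ->; case: (path3_cases d) => -> // _ _ _;
  by case: (path3_cases e) => ->; case: (path3_cases g) => ->.
Qed.

Theorem theorem3p4 (s t : nat) (hs : 2 <= s) (ht : 2 <= t) :
  [/\ 4 <= s /\ 4 <= t ->
        fixing_number (conormal (path_graph s) (path_graph t)) = 1,
      s = 2 /\ 4 <= t ->
        fixing_number (conormal (path_graph s) (path_graph t)) = 2,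
      (s = 2 /\ t = 2) \/ (s = 2 /\ t = 3) ->
        fixing_number (conormal (path_graph s) (path_graph t)) = 3,
      s = 3 /\ t = 3 ->
        fixing_number (conormal (path_graph s) (path_graph t)) = 5
    & s = 3 /\ 4 <= t ->
        fixing_number (conormal (path_graph s) (path_graph t)) = t + 1].
Proof.
split.
- case: s hs => [|[|[|[|m]]]] _ [] //; case: t ht => [|[|[|[|n]]]] // _ _ _.
  exact: fixing_number_long_paths.
- case=> ->; case: t ht => [|[|[|[|n]]]] // _ _.
  exact: fixing_number_path2_long.
- by case=> [] [-> ->]; [apply: fixing_number_path22 | apply: fixing_number_path23].
- by case=> -> ->; apply: fixing_number_path33.
- case=> ->; case: t ht => [|[|[|[|n]]]] // _ _.
  by rewrite addn1; apply: fixing_number_path3_long.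
Qed.
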